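(* Let $A=\sigma(R)\langle x_1,\dots,x_n\rangle$ be a skew PBW extension over a ring $R$, with associated system $(\Sigma,\Delta)$ of endomorphisms and $\Sigma$-derivations of $R$. Then the following statements are equivalent: (1) $R$ is $\Sigma$-semicommutative and reduced. (2) $R$ is $\Sigma$-rigid. (3) $R$ is $(\Sigma,\Delta)$-Armendariz and reduced. (4) $A$ is reduced. (5) $R$ is reduced and $(\Sigma,\Delta)$-compatible. (6) $R$ is reduced and skew-Armendariz.
   Context: Rings are associative with identity; $\mathbb{N}$ includes $0$. A ring is reduced if it has no nonzero nilpotent elements. Skew PBW extension: $A=\sigma(R)\langle x_1,\dots,x_n\rangle$ is a skew PBW extension over $R$ if (i) $R$ is a subring of $A$ with the same identity; (ii) there are $x_1,\dots,x_n\in A$ such that $A$ is a free left $R$-module with basis $\mathrm{Mon}(A):=\{x^\alpha:=x_1^{\alpha_1}\cdots x_n^{\alpha_n}\mid \alpha=(\alpha_1,\dots,\alpha_n)\in\mathbb{N}^n\}$; (iii) for each $i$ and each $r\in R\setminus\{0\}$ there is $c_{i,r}\in R\setminus\{0\}$ with $x_ir-c_{i,r}x_i\in R$; (iv) for all $1\le i,j\le n$ there is $d_{i,j}\in R\setminus\{0\}$ with $x_jx_i-d_{i,j}x_ix_j\in R+Rx_1+\cdots+Rx_n$. For such $A$, for each $i$ there are an injective ring endomorphism $\sigma_i$ of $R$ and a $\sigma_i$-derivation $\delta_i$ of $R$ (an additive map with $\delta_i(rs)=\sigma_i(r)\delta_i(s)+\delta_i(r)s$) such that $x_ir=\sigma_i(r)x_i+\delta_i(r)$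 for all $r\in R$. Put $\Sigma:=\{\sigma_1,\dots,\sigma_n\}$, $\Delta:=\{\delta_1,\dots,\delta_n\}$, and for $\alpha\in\mathbb{N}^n$, $\sigma^\alpha:=\sigma_1^{\alpha_1}\circ\cdots\circ\sigma_n^{\alpha_n}$, $\delta^\alpha:=\delta_1^{\alpha_1}\circ\cdots\circ\delta_n^{\alpha_n}$. $R$ is $\Sigma$-semicommutative if for all $a,b\in R$, $ab=0$ implies $aR\sigma^\alpha(b)=0$ for every $\alpha\in\mathbb{N}^n\setminus\{0\}$. $R$ is $\Sigma$-rigid if for all $a\in R$ and $\alpha\in\mathbb{N}^n$, $a\sigma^\alpha(a)=0$ implies $a=0$. $R$ is $(\Sigma,\Delta)$-compatible if it is $\Sigma$-compatible (for all $a,b\in R$ and $\alpha\in\mathbb{N}^n$: $a\sigma^\alpha(b)=0$ if and only if $ab=0$) and $\Delta$-compatible (for all $a,b\in R$ and $\beta\in\mathbb{N}^n$: $ab=0$ implies $a\delta^\beta(b)=0$). In the next definitions elements of $A$ are written $f=a_0+a_1X_1+\cdots+a_mX_m$ and $g=b_0+b_1Y_1+\cdots+b_tY_t$, with coefficients in $R$, the $X_i$ ($i\ge1$) pairwise distinct elements of $\mathrm{Mon}(A)\setminus\{1\}$, likewise the $Y_j$, and $X_0=Y_0=1$. $R$ is $(\Sigma,\Delta)$-Armendariz if for all such $f,g\in A$, $fg=0$ implies $a_iX_ib_jY_j=0$ for all $i,j$. $R$ is skew-Armendariz if for all such $f,g\in A$, $fg=0$ implies $a_0b_k=0$ for each $0\le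 k\le t$. *)

(* Defs.v *)
From HB Require Import structures.
From mathcomp Require Import all_boot all_order all_algebra.
From mathcomp.multinomials Require Import mpoly.
From Stdlib Require Import ClassicalEpsilon.

Set Implicit Arguments.
Unset Strict Implicit.
Unset Printing Implicit Defensive.

Import GRing.Theory.
Local Open Scope ring_scope.

(* Rings are [pzRingType]s: associative and unital, the zero ring is allowed. *)
Definition reduced (R : pzRingType) : Prop :=
  forall (a : R) (k : nat), a ^+ k = 0 -> a = 0.

(* The composite F_1^(al_1) \o ... \o F_n^(al_n), in this order. *)
Definition iter_comp (T : Type) (n : nat) (F : 'I_n -> T -> T)
    (al : 'X_{1..n}) : T -> T :=
  \big[comp/idfun]_(i < n) iter (al i) (F i).

Section SkewPBW.

(* R is regarded as a subring of A through the injective morphism iota. *)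
Variables (R A : pzRingType) (iota : {rmorphism R -> A}).
Variables (n : nat) (x : 'I_n -> A).

(* The standard monomial x_1^(al_1) * ... * x_n^(al_n); the big product is taken
   in increasing order of the index, which matters as A is not commutative. *)
Definition stdmon (al : 'X_{1..n}) : A := \prod_(i < n) x i ^+ al i.

(* The family of standard monomials is a basis of A as a left R-module. *)
Definition stdmon_basis : Prop :=
  (forall f : A, exists (s : seq 'X_{1..n}) (a : 'X_{1..n} -> R),
     f = \sum_(al <- s) iota (a al) * stdmon al) /\
  (forall (s : seq 'X_{1..n}) (a : 'X_{1..n} -> R), uniq s ->
     \sum_(al <- s) iota (a al) * stdmon al = 0 ->
     forall al, al \in s -> a al = 0).

Definition skew_PBW_extension : Prop :=
  [/\ injective iota,
      stdmon_basis,
      forall (i : 'I_n) (r : R), r != 0 ->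
        exists2 c : R, c != 0 &
        exists s : R, x i * iota r - iota c * x i = iota s
    & forall i j : 'I_n,
        exists2 d : R, d != 0 &
        exists (s : R) (t : 'I_n -> R),
          x j * x i - iota d * x i * x j
            = iota s + \sum_(k < n) iota (t k) * x k].

Variables (sigma : 'I_n -> {rmorphism R -> R}).
Variables (delta : 'I_n -> {additive R -> R}).

Definition PBW_system : Prop :=
  forall i : 'I_n,
    [/\ injective (sigma i),
        forall r s : R, delta i (r * s) = sigma i r * delta i s + delta i r * s
      & forall r : R, x i * iota r = iota (sigma i r) * x i + iota (delta i r)].

Definition sigma_pow (al : 'X_{1..n}) : R -> R :=
  iter_comp (fun i => sigma i : R -> R) al.

Definition delta_pow (al : 'X_{1..n}) : R -> R :=
  iter_comp (fun i => delta i : R -> R) al.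

Definition Sigma_semicommutative : Prop :=
  forall a b : R, a * b = 0 ->
  forall al : 'X_{1..n}, al != 0%MM ->
  forall r : R, a * r * sigma_pow al b = 0.

Definition Sigma_rigid : Prop :=
  forall (a : R) (al : 'X_{1..n}), a * sigma_pow al a = 0 -> a = 0.

Definition Sigma_compatible : Prop :=
  forall (a b : R) (al : 'X_{1..n}), a * sigma_pow al b = 0 <-> a * b = 0.

Definition Delta_compatible : Prop :=
  forall (a b : R) (be : 'X_{1..n}), a * b = 0 -> a * delta_pow be b = 0.

Definition Sigma_Delta_compatible : Prop :=
  Sigma_compatible /\ Delta_compatible.

(* The element a_0 X_0 + ... + a_m X_m of A, the monomials X_k being given by
   their exponents. *)
Definition stdsum (m : nat) (a : 'I_m.+1 -> R) (X : 'I_m.+1 -> 'X_{1..n}) : A :=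
  \sum_(k < m.+1) iota (a k) * stdmon (X k).

(* X_0 = 1, and X_1, ..., X_m are pairwise distinct and different from 1. *)
Definition admissible (m : nat) (X : 'I_m.+1 -> 'X_{1..n}) : Prop :=
  X ord0 = 0%MM /\ injective X.

Definition Sigma_Delta_Armendariz : Prop :=
  forall (m t : nat) (a : 'I_m.+1 -> R) (X : 'I_m.+1 -> 'X_{1..n})
         (b : 'I_t.+1 -> R) (Y : 'I_t.+1 -> 'X_{1..n}),
    admissible X -> admissible Y ->
    stdsum a X * stdsum b Y = 0 ->
    forall (i : 'I_m.+1) (j : 'I_t.+1),
      iota (a i) * stdmon (X i) * (iota (b j) * stdmon (Y j)) = 0.

Definition skew_Armendariz : Prop :=
  forall (m t : nat) (a : 'I_m.+1 -> R) (X : 'I_m.+1 -> 'X_{1..n})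
         (b : 'I_t.+1 -> R) (Y : 'I_t.+1 -> 'X_{1..n}),
    admissible X -> admissible Y ->
    stdsum a X * stdsum b Y = 0 ->
    forall k : 'I_t.+1, a ord0 * b k = 0.

End SkewPBW.

(* Every skew PBW extension has exactly one system (Sigma, Delta), so that
   quantifying over all of them amounts to speaking of that one. *)
Section SystemExistsUnique.

Variables (R A : pzRingType) (iota : {rmorphism R -> A}).
Variables (n : nat) (x : 'I_n -> A).
Hypothesis PBW : skew_PBW_extension iota x.

Lemma stdmon0 : stdmon x 0%MM = 1.
Proof. by rewrite /stdmon big1 // => i _; rewrite mnm0E expr0. Qed.

Lemma stdmonU (i : 'I_n) : stdmon x U_(i)%MM = x i.
Proof.
have aux : forall (s : seq 'I_n), uniq s ->
    \prod_(j <- s) x j ^+ U_(i)%MM j = if i \in s then x i else 1.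
  elim=> [|j s IHs] /=; first by rewrite big_nil.
  case/andP=> js us; rewrite big_cons IHs // mnm1E inE.
  case: eqVneq => [eij|_] /=; last by rewrite expr0 mul1r.
  by rewrite -eij in js *; rewrite (negPf js) expr1 mulr1.
by rewrite /stdmon aux ?index_enum_uniq // mem_index_enum.
Qed.

Lemma linear_coef_inj (i : 'I_n) (a b a' b' : R) :
  iota a * x i + iota b = iota a' * x i + iota b' -> a = a' /\ b = b'.
Proof.
move=> e; case: PBW => _ [_ indep] _ _.
have U0 : U_(i)%MM != 0%MM :> 'X_{1..n}.
  by apply/eqP => /mnmP/(_ i); rewrite mnm1E mnm0E eqxx.
pose s := [:: U_(i)%MM; 0%MM : 'X_{1..n}].
pose c (al : 'X_{1..n}) := if al == 0%MM then b - b' else a - a'.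
have us : uniq s by rewrite /s /= inE U0.
have z : \sum_(al <- s) iota (c al) * stdmon x al = 0.
  rewrite /s /c !big_cons big_nil (negPf U0) eqxx stdmon0 stdmonU.
  rewrite mulr1 addr0 !rmorphB mulrBl addrACA -opprD.
  by apply/eqP; rewrite subr_eq0 e.
have cU := indep s c us z U_(i)%MM; have c0 := indep s c us z 0%MM.
move: cU c0; rewrite /c (negPf U0) eqxx /s !inE !eqxx orbT.
by move=> /(_ isT)/eqP + /(_ isT)/eqP; rewrite !subr_eq0 => /eqP -> /eqP ->.
Qed.

Lemma PBW_system_exists :
  exists (sigma : 'I_n -> {rmorphism R -> R}) (delta : 'I_n -> {additive R -> R}),
    PBW_system iota x sigma delta.
Proof.
case: (PBW) => _ _ comm _.
have ex (i : 'I_n) (r : R) : exists p : R * R,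
    (p.1 = 0 -> r = 0) /\ x i * iota r = iota p.1 * x i + iota p.2.
  case: (eqVneq r 0) => [->|r0].
    by exists (0, 0); rewrite !rmorph0 mulr0 mul0r addr0.
  have [c c0 [s e]] := comm i r r0; exists (c, s); split=> /=.
    by move/eqP; rewrite (negPf c0).
  by rewrite -e addrC subrK.
pose p i r := proj1_sig (constructive_indefinite_description _ (ex i r)).
pose f i r := (p i r).1; pose g i r := (p i r).2.
have fz i r : f i r = 0 -> r = 0.
  by rewrite /f /p; case: constructive_indefinite_description => ? [].
have fg i r : x i * iota r = iota (f i r) * x i + iota (g i r).
  by rewrite /f /g /p; case: constructive_indefinite_description => ? [].
have fgB i r s : f i (r - s) = f i r - f i s /\ g i (r - s) = g i r - g i s.
  apply: (@linear_coef_inj i); rewrite -fg !rmorphB mulrBr !fg.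
  by rewrite mulrBl opprD addrACA.
have fg1 i : f i 1 = 1 /\ g i 1 = 0.
  by apply: (@linear_coef_inj i); rewrite -fg rmorph1 rmorph0 mulr1 mul1r addr0.
have fgM i r s : f i (r * s) = f i r * f i s /\
    g i (r * s) = f i r * g i s + g i r * s.
  apply: (@linear_coef_inj i); rewrite -fg rmorphM mulrA fg mulrDl -mulrA fg.
  by rewrite mulrDr !mulrA !rmorphD !rmorphM addrA.
have fD i : zmod_morphism (f i) by move=> r s; case: (fgB i r s).
have gD i : zmod_morphism (g i) by move=> r s; case: (fgB i r s).
have fM i : monoid_morphism (f i).
  by split=> [|r s]; [case: (fg1 i) | case: (fgM i r s)].
pose fA i := GRing.isZmodMorphism.Build R R (f i) (fD i).
pose fR i := GRing.isMonoidMorphism.Build R R (f i) (fM i).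
pose gA i := GRing.isZmodMorphism.Build R R (g i) (gD i).
pose sigma i : {rmorphism R -> R} := HB.pack (f i) (fA i) (fR i).
pose delta i : {additive R -> R} := HB.pack (g i) (gA i).
exists sigma, delta => i; split=> [r s /= e|r s|r] /=.
- by apply/eqP; rewrite -subr_eq0; apply/eqP/(fz i); rewrite fD e subrr.
- by case: (fgM i r s).
- exact: fg.
Qed.

Lemma PBW_system_unique (sigma sigma' : 'I_n -> {rmorphism R -> R})
    (delta delta' : 'I_n -> {additive R -> R}) :
  PBW_system iota x sigma delta -> PBW_system iota x sigma' delta' ->
  forall i, sigma i =1 sigma' i /\ delta i =1 delta' i.
Proof.
move=> sys sys' i; have [_ _ e] := sys i; have [_ _ e'] := sys' i.
have main r : sigma i r = sigma' i r /\ delta i r = delta' i r.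
  by apply: (@linear_coef_inj i); rewrite -e -e'.
by split=> r; case: (main r).
Qed.

End SystemExistsUnique.

(* Main.v *)
Require Import Defs.
From HB Require Import structures.
From mathcomp Require Import all_boot all_order all_algebra.
From mathcomp.multinomials Require Import mpoly.
From Stdlib Require Import ClassicalEpsilon.

Set Implicit Arguments.
Unset Strict Implicit.
Unset Printing Implicit Defensive.

Import Order.TTheory GRing.Theory.
Local Open Scope ring_scope.

(** All six conditions are equivalent to one local condition: [R] is reduced and
    every single [sigma i] is rigid, that is [a * sigma i a = 0] forces [a = 0].

    From the local condition. In a reduced ring zero products are reversible, and
    rigidity then makes every [sigma i] preserve and reflect them
    ([rigid_compatible]), while every [delta i] preserves them
    ([rigid_derivation_weakly_compatible]); composites inherit this, which gives
    rigidity, semicommutativity and compatibility for all exponents. The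
    conditions on [A] follow from one fact: if [f * g = 0] then
    [a * b = 0] for every coefficient [a] of [f] and every coefficient [b] of [g]
    ([zero_prod_coefs]). Among the pairs of terms that violate it, take one whose
    exponents have the largest sum in the degree lexicographic order and, among
    these, the largest exponent on the side of [g]. After multiplying
    [f * g = 0] on the left by the coefficient [b] of this pair, no other pair
    contributes to the coefficient at the sum of its two exponents, so that
    [b * a * sigma^al b * c = 0] with [c] the coefficient of the leading monomial
    in a product of two standard monomials. Such a [c] is invertible on the right
    ([coef_prod]), hence [b * a * b = 0] and [a * b = 0].

    The leading monomial of a product is found by working with words in the
    variables, filtered by length: modulo shorter words, letters commute up to
    scalars that have an inverse, because the scalar that exchanges [x i] and
    [x j] is inverse to the one that exchanges them back.

    Back to the local condition. Semicommutativity applied to [sigma i a * a = 0]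
    gives [sigma i a] squared equal to [0]. If [A] is reduced, [x i] may be
    inserted in [sigma i a * a = 0]. For the Armendariz conditions, the zero
    product [(x i * b) * c = 0] for [b * c = 0] shows that [delta i] preserves
    zero products, and then
    [(sigma i a + sigma i a * x i) * (a - sigma i a * x i) = 0]
    yields [sigma i a] squared equal to [0] ([skew_Armendariz_rigid]). *)

(** * Reduced rings *)

Lemma sqr_eq0_reduced (R : pzRingType) :
  (forall a : R, a * a = 0 -> a = 0) -> reduced R.
Proof.
move=> sqr0 a [|k]; first by move=> e; rewrite -[a]mul1r -(expr0 a) e mul0r.
elim: k => [|k IHk]; first by rewrite expr1.
move=> ak; apply/IHk/sqr0.
by rewrite -exprD addSnnS exprD ak mulr0.
Qed.

Section ReducedRing.

Variable R : pzRingType.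
Hypothesis redR : reduced R.
Implicit Types a b r : R.

Lemma reduced_sqr_eq0 a : a * a = 0 -> a = 0.
Proof. by move=> e; apply: (redR (k := 2)); rewrite expr2. Qed.

Lemma reduced_mul_eq0C a b : a * b = 0 -> b * a = 0.
Proof.
by move=> ab; apply: reduced_sqr_eq0; rewrite mulrA -(mulrA b) ab mulr0 mul0r.
Qed.

Lemma reduced_mul_ins a b r : a * b = 0 -> a * r * b = 0.
Proof.
move=> /reduced_mul_eq0C ba; apply: reduced_sqr_eq0.
by rewrite -!mulrA (mulrA b) ba mul0r !mulr0.
Qed.

(** The idempotent [1 - b * a] annihilates [b] from the left, hence from the
    right. *)
Lemma reduced_invC a b : a * b = 1 -> b * a = 1.
Proof.
move=> ab; have e : (1 - b * a) * b = 0.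
  by rewrite mulrBl mul1r -mulrA ab mulr1 subrr.
have := congr1 ( *%R a) (reduced_mul_eq0C e).
by rewrite mulr0 mulrA ab mul1r => /eqP; rewrite subr_eq0 => /eqP.
Qed.

End ReducedRing.

(** * Endomorphisms and derivations that preserve zero products *)

Section Compatible.

Variable R : pzRingType.

Definition rigid (s : R -> R) : Prop := forall a, a * s a = 0 -> a = 0.

Definition compatible (s : R -> R) : Prop :=
  forall a b, a * s b = 0 <-> a * b = 0.

Definition weakly_compatible (d : R -> R) : Prop :=
  forall a b, a * b = 0 -> a * d b = 0.

(** Induction on composites, for properties such as compatibility that the
    identity has and composition preserves. *)
Lemma iter_comp_ind (T : Type) (K : (T -> T) -> Prop) (n : nat)
    (F : 'I_n -> T -> T) :
  K idfun -> (forall f g, K f -> K g -> K (f \o g)) -> (forall i, K (F i)) ->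
  forall al, K (iter_comp F al).
Proof.
move=> K1 KM KF al; apply: (big_ind K) => // i _.
by elim: (al i) => [|k IHk] //; apply: (KM (F i)).
Qed.

Lemma iter_comp0 (T : Type) (n : nat) (F : 'I_n -> T -> T) (y : T) :
  iter_comp F 0%MM y = y.
Proof.
by apply: (big_ind (fun h : T -> T => h y = y)) => // [f g /= + ->|i _];
  rewrite ?mnm0E.
Qed.

Lemma iter_compU (T : Type) (n : nat) (F : 'I_n -> T -> T) (i : 'I_n) (y : T) :
  iter_comp F U_(i)%MM y = F i y.
Proof.
have aux : forall (s : seq 'I_n), uniq s ->
    (\big[comp/idfun]_(j <- s) iter (U_(i)%MM j) (F j)) y =
      if i \in s then F i y else y.
  elim=> [|j s IHs] /=; first by rewrite big_nil.
  case/andP=> js us; rewrite big_cons /= IHs // mnm1E inE.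
  by case: eqVneq => [eij|_] //=; rewrite eij (negPf js).
by rewrite /iter_comp aux ?index_enum_uniq // mem_index_enum.
Qed.

Lemma compatible_iter n (F : 'I_n -> R -> R) al :
  (forall i, compatible (F i)) -> compatible (iter_comp F al).
Proof.
move=> FC; apply: iter_comp_ind => // f g fC gC a b /=.
by rewrite (fC a (g b)) (gC a b).
Qed.

Lemma weakly_compatible_iter n (F : 'I_n -> R -> R) al :
  (forall i, weakly_compatible (F i)) -> weakly_compatible (iter_comp F al).
Proof.
by move=> FC; apply: iter_comp_ind => // f g fC gC a b ab; apply/fC/gC.
Qed.

Hypothesis redR : reduced R.

Lemma compatible_rigid (s : R -> R) : compatible s -> rigid s.
Proof. by move=> sC a /sC/(reduced_sqr_eq0 redR). Qed.

Variables (s : {rmorphism R -> R}) (d : {additive R -> R}).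
Hypothesis s_rigid : rigid s.
Hypothesis dM : forall a b, d (a * b) = s a * d b + d a * b.

(** With [t := a * s b], the product [t * s t] contains [s (b * a)]; with
    [t := b * a], it contains [a * s b]. *)
Lemma rigid_compatible : compatible s.
Proof.
move=> a b; split=> ab; last first.
  apply: s_rigid; rewrite rmorphM -mulrA (mulrA (s b)) -rmorphM.
  by rewrite (reduced_mul_eq0C redR ab) rmorph0 mul0r mulr0.
apply: (reduced_mul_eq0C redR); apply: s_rigid.
by rewrite rmorphM -mulrA (mulrA a) ab mul0r mulr0.
Qed.

(** Differentiating [a * b = 0] gives [s a * d b = - d a * b]. As
    [b * s a = 0], the square of [s a * d b] vanishes, and compatibility of [s]
    turns [d b * s a = 0] into [d b * a = 0]. *)
Lemma rigid_derivation_weakly_compatible : weakly_compatible d.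
Proof.
move=> a b ab; have sC := rigid_compatible.
have ba := reduced_mul_eq0C redR ab.
have bsa : b * s a = 0 by apply/sC.
have sadb : s a * d b = 0.
  apply: (reduced_sqr_eq0 redR); rewrite mulrA.
  have /(congr1 ( *%R^~ (s a))) := dM a b.
  rewrite ab raddf0 mul0r mulrDl -(mulrA (d a)) bsa mulr0 addr0 => <-.
  by rewrite mul0r.
by apply/(reduced_mul_eq0C redR)/sC/(reduced_mul_eq0C redR).
Qed.

End Compatible.

(** * Coordinates in the basis of standard monomials *)

Section Coordinates.

Variables (R A : pzRingType) (iota : {rmorphism R -> A}).
Variables (n : nat) (x : 'I_n -> A).
Implicit Types (f g : A) (ga : 'X_{1..n}) (p q : seq (R * 'X_{1..n})).

(** Left combinations of standard monomials are encoded as lists of terms in which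
    an exponent may be repeated, so that addition is concatenation. *)
Definition lincomb p : A := \sum_(t <- p) iota t.1 * stdmon x t.2.

Definition weight p ga : R := \sum_(t <- p | t.2 == ga) t.1.

(** A representation is chosen for every [f]; by independence its total weight at
    [ga] does not depend on the choice, see [coef_lincomb]. *)
Definition coef ga f : R :=
  weight (epsilon (inhabits [::]) (fun p => f = lincomb p)) ga.

Hypothesis basis : stdmon_basis iota x.

Lemma lincomb_cat p q : lincomb (p ++ q) = lincomb p + lincomb q.
Proof. exact: big_cat. Qed.

Lemma weight_cat p q ga : weight (p ++ q) ga = weight p ga + weight q ga.
Proof. exact: big_cat. Qed.

Definition oppc p := [seq (- t.1, t.2) | t <- p].

Lemma lincombN p : lincomb (oppc p) = - lincomb p.
Proof.
rewrite /lincomb big_map /= -sumrN; apply: eq_bigr => t _.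
by rewrite rmorphN mulNr.
Qed.

Lemma weightN p ga : weight (oppc p) ga = - weight p ga.
Proof. by rewrite /weight big_map /= -sumrN. Qed.

Lemma lincomb_collect p :
  lincomb p =
    \sum_(al <- undup [seq t.2 | t <- p]) iota (weight p al) * stdmon x al.
Proof.
rewrite /lincomb; set s := undup _.
under [RHS]eq_bigr => al _ do
  rewrite /weight rmorph_sum mulr_suml big_mkcond.
rewrite exchange_big /= !big_seq; apply: eq_bigr => t tp.
rewrite (bigD1_seq t.2) ?undup_uniq ?mem_undup ?map_f //= eqxx big1 ?addr0 //.
by move=> al; rewrite eq_sym => /negPf->.
Qed.

Lemma lincomb_eq0 p ga : lincomb p = 0 -> weight p ga = 0.
Proof.
case: basis => _ indep; rewrite lincomb_collect; set s := undup _ => p0.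
have [/(indep s _ (undup_uniq _) p0)//|nga] := boolP (ga \in s).
rewrite /weight big_seq_cond big1 // => t /andP[tp /eqP eg].
by rewrite /s -eg mem_undup map_f in nga.
Qed.

Lemma coef_lincomb p ga : coef ga (lincomb p) = weight p ga.
Proof.
rewrite /coef.
have /(epsilon_spec (inhabits [::])) :
  exists q, lincomb p = lincomb q by exists p.
set q := epsilon _ _ => pq.
have : weight (q ++ oppc p) ga = 0.
  by apply: lincomb_eq0; rewrite lincomb_cat lincombN pq subrr.
by rewrite weight_cat weightN => /eqP; rewrite subr_eq0 => /eqP.
Qed.

Lemma lincombP f : exists p, f = lincomb p.
Proof.
case: basis => gen _; have [s [a ->]] := gen f.
by exists [seq (a al, al) | al <- s]; rewrite /lincomb big_map.
Qed.

Lemma injective_lincomb f :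
  exists (m : nat) (a : 'I_m -> R) (X : 'I_m -> 'X_{1..n}),
    injective X /\ f = \sum_(i < m) iota (a i) * stdmon x (X i).
Proof.
have [p ->] := lincombP f; rewrite lincomb_collect; set s := undup _.
exists (size s), (fun i => weight p (tnth (in_tuple s) i)), (tnth (in_tuple s)).
by split; [apply/tuple_uniqP; apply: undup_uniq | rewrite big_tnth].
Qed.

Lemma coefD ga f g : coef ga (f + g) = coef ga f + coef ga g.
Proof.
have [[p ->] [q ->]] := (lincombP f, lincombP g).
by rewrite -lincomb_cat !coef_lincomb weight_cat.
Qed.

Lemma coef_stdmon ga r al :
  coef ga (iota r * stdmon x al) = if al == ga then r else 0.
Proof.
have -> : iota r * stdmon x al = lincomb [:: (r, al)].
  by rewrite /lincomb big_seq1.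
by rewrite coef_lincomb /weight big_mkcond big_seq1.
Qed.

Lemma coef0 ga : coef ga 0 = 0.
Proof.
have -> : 0 = lincomb [::] by rewrite /lincomb big_nil.
by rewrite coef_lincomb /weight big_nil.
Qed.

Lemma coef_sum ga (I : Type) (s : seq I) (F : I -> A) :
  coef ga (\sum_(i <- s) F i) = \sum_(i <- s) coef ga (F i).
Proof. exact: (big_morph _ (coefD ga) (coef0 ga)). Qed.

Lemma coef_scale ga r f : coef ga (iota r * f) = r * coef ga f.
Proof.
have [p ->] := lincombP f.
rewrite /lincomb mulr_sumr !coef_sum mulr_sumr; apply: eq_bigr => t _.
by rewrite mulrA -rmorphM !coef_stdmon; case: ifP; rewrite ?mulr0.
Qed.

End Coordinates.

(** * Words in the variables *)

Section Words.

Variables (R A : pzRingType) (iota : {rmorphism R -> A}).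
Variables (n : nat) (x : 'I_n -> A).
Variables (sigma : 'I_n -> {rmorphism R -> R}).
Variables (delta : 'I_n -> {additive R -> R}).
Hypothesis PBW : skew_PBW_extension iota x.
Hypothesis system : PBW_system iota x sigma delta.
Implicit Types (f g : A) (u v w : seq 'I_n) (al be ga : 'X_{1..n}).

Definition word w : A := \prod_(i <- w) x i.

(** The leading part of the rule that moves a scalar to the left across a
    word. *)
Definition sigma_word w : R -> R := foldr (fun i h => sigma i \o h) idfun w.

(** The additive filtration of [A] by the length of words. Arbitrary words are used
    rather than standard monomials, which makes compatibility with products
    immediate; the comparison with degrees of standard monomials is
    [coef_lower]. *)
Inductive lower (d : nat) : A -> Prop :=
| lower0 : lower d 0
| lower_cons r w f :
    (size w < d)%N -> lower d f -> lower d (iota r * word w + f).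

Lemma word0 : word [::] = 1.
Proof. exact: big_nil. Qed.

Lemma word1 i : word [:: i] = x i.
Proof. exact: big_seq1. Qed.

Lemma word_cons i w : word (i :: w) = x i * word w.
Proof. exact: big_cons. Qed.

Lemma word_cat u v : word (u ++ v) = word u * word v.
Proof. exact: big_cat. Qed.

Lemma x_iota i r : x i * iota r = iota (sigma i r) * x i + iota (delta i r).
Proof. by case: (system i). Qed.

Lemma lowerD d f g : lower d f -> lower d g -> lower d (f + g).
Proof.
move=> lf lg; elim: lf => [|r w h sw _ IH]; first by rewrite add0r.
by rewrite -addrA; apply: lower_cons.
Qed.

Lemma lower_word d r w : (size w < d)%N -> lower d (iota r * word w).
Proof.
move=> sw; rewrite -[X in lower _ X]addr0.
by apply: lower_cons => //; apply: lower0.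
Qed.

Lemma lowerW d e f : (d <= e)%N -> lower d f -> lower e f.
Proof.
move=> de; elim=> [|r w g sw _ IH]; first exact: lower0.
by apply: lower_cons => //; apply: leq_trans de.
Qed.

Lemma lower_scale d r f : lower d f -> lower d (iota r * f).
Proof.
elim=> [|s w g sw _ IH]; first by rewrite mulr0; apply: lower0.
by rewrite mulrDr mulrA -rmorphM; apply: lower_cons.
Qed.

Lemma lower_xl d i f : lower d f -> lower d.+1 (x i * f).
Proof.
elim=> [|s w g sw _ IH]; first by rewrite mulr0; apply: lower0.
rewrite mulrDr mulrA x_iota mulrDl -mulrA -word_cons -addrA.
by apply: lower_cons => //; apply: lower_cons => //; apply: ltnW.
Qed.

Lemma lower_wordr d u f : lower d f -> lower (d + size u)%N (f * word u).
Proof.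
elim=> [|s w g sw _ IH]; first by rewrite mul0r; apply: lower0.
rewrite mulrDl -mulrA -word_cat; apply: lower_cons => //.
by rewrite size_cat ltn_add2r.
Qed.

Lemma word_iota w r :
  lower (size w) (word w * iota r - iota (sigma_word w r) * word w).
Proof.
elim: w => [|i w IH].
  by rewrite word0 mulr1 mul1r subrr; apply: lower0.
rewrite word_cons -mulrA -[word w * _](subrK (iota (sigma_word w r) * word w)).
rewrite mulrDr (mulrA (x i) (iota _)) x_iota mulrDl -[iota _ * x i * _]mulrA.
rewrite addrA addrAC addrK.
by apply: lowerD; [apply: lower_xl | apply: lower_word => /=].
Qed.

Lemma stdmon_word al : stdmon x al = word (m2s al).
Proof.
rewrite /word /m2s big_flatten big_map enumT /=.
apply: eq_bigr => i _.
by rewrite big_nseq iter_mulr_1.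
Qed.

Lemma m2sP al i : count_mem i (m2s al) = al i.
Proof. by rewrite -[in RHS](s2mK al) mnmE. Qed.

(** [m2s (s2m w)] is the sorted rearrangement of [w], whose product is a standard
    monomial by [stdmon_word]. *)
Lemma perm_m2s_s2m w : perm_eq w (m2s (s2m w)).
Proof. by apply/allP => i _ /=; rewrite m2sP mnmE. Qed.

Lemma mdeg_s2m w : mdeg (s2m w) = size w.
Proof. by rewrite -size_m2s -(perm_size (perm_m2s_s2m w)). Qed.

Lemma s2m_cat_m2s al be : s2m (m2s al ++ m2s be) = (al + be)%MM.
Proof. by apply/mnmP => i; rewrite mnmE count_cat !m2sP mnmDE. Qed.

Lemma coef_degree1 ga r (t : 'I_n -> R) : (1 < mdeg ga)%N ->
  coef iota x ga (iota r + \sum_(k < n) iota (t k) * x k) = 0.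
Proof.
case: PBW => _ basis _ _ gt1.
have low al s : (mdeg al <= 1)%N -> coef iota x ga (iota s * stdmon x al) = 0.
  move=> le1; rewrite coef_stdmon //; case: eqP => // e.
  by rewrite e leqNgt gt1 in le1.
rewrite coefD // -[iota r]mulr1 -(stdmon0 x) low ?mdeg0 // add0r.
rewrite coef_sum // big1 // => k _.
by rewrite -(stdmonU x k) low // mdeg1.
Qed.

(** One of the two products is in standard order. *)
Lemma stdmon_two i j :
  x i * x j = stdmon x (U_(i) + U_(j))%MM \/
  x j * x i = stdmon x (U_(i) + U_(j))%MM.
Proof.
have s2m2 : s2m [:: i; j] = (U_(i) + U_(j))%MM.
  by apply/mnmP => k; rewrite mnmE mnmDE !mnm1E /= addn0.
have := perm_m2s_s2m [:: i; j]; have := size_m2s (s2m [:: i; j]).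
rewrite mdeg_s2m s2m2 stdmon_word.
case: (m2s _) => [|k [|l []]] //= _ p; rewrite /word !big_cons big_nil mulr1.
have : k \in [:: i; j] by rewrite (perm_mem p) mem_head.
rewrite !inE => /orP[] /eqP ek; subst k.
  left; move: p; rewrite perm_cons => /perm_small_eq p.
  by case: (p isT) => ->.
right; move: p; rewrite (perm_catC [:: i] [:: j]) perm_cons => /perm_small_eq p.
by case: (p isT) => ->.
Qed.

Hypothesis redR : reduced R.

(** Exchanging two variables and exchanging them back multiplies the standard one
    of the two products by [d * d'] or [d' * d], which is therefore [1]; in a
    reduced ring the other one is then also [1]. *)
Lemma x_swap i j : exists d d' : R, d * d' = 1 /\
  lower 2%N (x i * x j - iota d * (x j * x i)).
Proof.
case: (PBW) => _ basis _ comm.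
have [d _ [s [t e]]] := comm j i; have [d' _ [s' [t' e']]] := comm i j.
exists d, d'; split; last first.
  rewrite mulrA e -[iota s]mulr1 -word0.
  apply: lowerD; first exact: lower_word.
  apply: (big_ind (lower 2%N)) => [|f g|k _]; [exact: lower0|exact: lowerD|].
  by rewrite -word1; apply: lower_word.
pose ga := (U_(i) + U_(j))%MM.
(* The relation that starts from the standard product is substituted in itself
   and its coefficients at [ga] are compared. *)
have inv (k l : 'I_n) (c c' r r' : R) (q q' : 'I_n -> R) :
    x k * x l - iota c * x l * x k = iota r + \sum_(h < n) iota (q h) * x h ->
    x l * x k - iota c' * x k * x l = iota r' + \sum_(h < n) iota (q' h) * x h ->
    x k * x l = stdmon x ga -> c * c' = 1.
  have ga2 : (1 < mdeg ga)%N by rewrite mdegD !mdeg1.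
  move=> /(canRL (subrK _)) E /(canRL (subrK _)) E' std.
  have := E; rewrite -mulrA E' -mulrA std => /(congr1 (coef iota x ga)).
  rewrite (coefD basis) coef_degree1 // (coef_scale basis) (coefD basis).
  rewrite coef_degree1 // (coef_scale basis) !add0r.
  rewrite -[stdmon x _]mul1r -(rmorph1 iota) coef_stdmon // eqxx mulr1.
  exact: esym.
have [std|std] := stdmon_two i j; first exact: inv e e' std.
exact/(reduced_invC redR)/(inv _ _ _ _ _ _ _ _ e' e std).
Qed.

(** The letter [i] passes the letters of [u] one at a time. Invertibility is
    recorded as the existence of a right inverse [c']: it lets [c] be cancelled on
    the right and is inherited by products and by images under [sigma]. *)
Lemma move_front i u v : exists c c' : R, c * c' = 1 /\
  lower (size (i :: u ++ v))
    (word (i :: u ++ v) - iota c * word (u ++ i :: v)).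
Proof.
elim: u => [|j u [c [c' [cc' low]]]] /=.
  exists 1, 1; split; first exact: mulr1.
  by rewrite rmorph1 mul1r subrr; apply: lower0.
have [d [d' [dd' low2]]] := x_swap i j.
exists (d * sigma j c), (sigma j c' * d'); split.
  by rewrite mulrA -(mulrA d) -rmorphM cc' rmorph1 mulr1.
pose q := x i * x j - iota d * (x j * x i).
pose l := word (i :: u ++ v) - iota c * word (u ++ i :: v).
have -> : word [:: i, j & u ++ v] - iota (d * sigma j c) * word (j :: u ++ i :: v)
    = q * word (u ++ v) + (iota d * (x j * l)
      + iota (d * delta j c) * word (u ++ i :: v)).
  rewrite /q /l !word_cons mulrBl mulrBr (mulrA (x j) (iota c)) x_iota.
  rewrite mulrDl !mulrBr !mulrDr !rmorphM !mulrA opprD.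
  by rewrite !addrA !subrK.
rewrite -/q in low2; apply: lowerD; first exact: lower_wordr low2.
apply: lowerD; first by apply/lower_scale/lower_xl.
by apply: lower_word; rewrite /= !size_cat addnS.
Qed.

(** Modulo shorter words, a word depends on the order of its letters only through
    an invertible scalar: bring the first letter of [w] to its place in [w']
    after rearranging the others. *)
Lemma word_perm w w' : perm_eq w w' -> exists c c' : R, c * c' = 1 /\
  lower (size w) (word w - iota c * word w').
Proof.
elim: w w' => [|i w IH] w'.
  rewrite perm_sym => /perm_nilP ->; exists 1, 1; split; first exact: mulr1.
  by rewrite rmorph1 mul1r subrr; apply: lower0.
move=> p; have iw' : i \in w' by rewrite -(perm_mem p) mem_head.
case/splitPr: iw' p => u v p; have {}p : perm_eq w (u ++ v) 
  by rewrite -(perm_cons i) (permPl p) (perm_catCA u [:: i] v).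
have [c [c' [cc' low]]] := IH _ p; have [d [d' [dd' low2]]] := move_front i u v.
exists (sigma i c * d), (d' * sigma i c'); split.
  by rewrite mulrA -(mulrA _ d) dd' mulr1 -rmorphM cc' rmorph1.
pose q := word (i :: u ++ v) - iota d * word (u ++ i :: v).
pose l := word w - iota c * word (u ++ v).
have -> : word (i :: w) - iota (sigma i c * d) * word (u ++ i :: v)
    = x i * l + (iota (delta i c) * word (u ++ v) + iota (sigma i c) * q).
  rewrite /q /l !word_cons !mulrBr (mulrA (x i) (iota c)) x_iota.
  rewrite mulrDl !rmorphM !mulrA opprD.
  by rewrite !addrA !subrK.
apply: lowerD; first exact: lower_xl.
apply: lowerD; first by apply: lower_word; rewrite /= (perm_size p).
by apply: lower_scale; rewrite /= (perm_size p).
Qed.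

(** Sorting a word changes it by shorter words, so that induction on the length
    reduces to standard monomials of degree less than [d]. *)
Lemma coef_lower d f ga : lower d f -> (d <= mdeg ga)%N ->
  coef iota x ga f = 0.
Proof.
case: PBW => _ basis _ _; elim: d f => [|d IHd] f.
  by elim=> [|//] _; rewrite coef0.
elim=> [|r w {}f sw _ IH] lt_d_ga; first by rewrite coef0.
rewrite (coefD basis) (coef_scale basis) IH // addr0.
have [c [c' [_ /(lowerW (ltnSE sw)) low]]] := word_perm (perm_m2s_s2m w).
have /(IHd _ low) low0 := ltnW lt_d_ga.
rewrite -[word w](subrK (iota c * word (m2s (s2m w)))) (coefD basis) low0.
rewrite -stdmon_word coef_stdmon // add0r.
case: eqP => [e|_]; last exact: mulr0.
by move: lt_d_ga; rewrite -e mdeg_s2m leqNgt sw.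
Qed.

(** The leading term of a product of two terms; the scalar [c] comes from sorting
    the concatenation of the two monomials. *)
Lemma coef_prod r s al be ga : (mdeg (al + be)%MM <= mdeg ga)%N ->
  exists c c' : R, c * c' = 1 /\
  coef iota x ga (iota r * stdmon x al * (iota s * stdmon x be))
    = if (al + be)%MM == ga then r * sigma_word (m2s al) s * c else 0.
Proof.
case: PBW => _ basis _ _ le_ga.
have := word_iota (m2s al) s; rewrite size_m2s; set t := sigma_word _ _ => low.
have [c [c' [cc' low2]]] := word_perm (perm_m2s_s2m (m2s al ++ m2s be)).
exists c, c'; split=> //.
rewrite s2m_cat_m2s size_cat !size_m2s in low2.
pose l := word (m2s al) * iota s - iota t * word (m2s al).
pose q := word (m2s al ++ m2s be) - iota c * word (m2s (al + be)%MM).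
have -> : iota r * stdmon x al * (iota s * stdmon x be)
  = iota r * (l * word (m2s be) + iota t * q)
    + iota (r * t * c) * stdmon x (al + be)%MM.
  rewrite !stdmon_word /l /q word_cat mulrBl mulrBr !mulrDr.
  by rewrite !mulrN !rmorphM !mulrA !addrA !subrK.
rewrite (coefD basis) (coef_scale basis).
rewrite (coef_lower (d := (mdeg al + mdeg be)%N)).
- by rewrite mulr0 add0r coef_stdmon.
- apply: lowerD; last exact: lower_scale.
  by rewrite -(size_m2s be); apply: lower_wordr.
- by rewrite -mdegD.
Qed.

End Words.

(** * Zero products in a skew PBW extension of a rigid ring *)

Section ZeroProducts.

Variables (R A : pzRingType) (iota : {rmorphism R -> A}).
Variables (n : nat) (x : 'I_n -> A).
Variables (sigma : 'I_n -> {rmorphism R -> R}).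
Variables (delta : 'I_n -> {additive R -> R}).
Hypothesis PBW : skew_PBW_extension iota x.
Hypothesis system : PBW_system iota x sigma delta.
Hypothesis redR : reduced R.
Hypothesis sigma_rigid : forall i, rigid (sigma i).

Lemma sigma_compatible i : compatible (sigma i).
Proof. exact: rigid_compatible. Qed.

Lemma delta_weakly_compatible i : weakly_compatible (delta i).
Proof.
apply: (@rigid_derivation_weakly_compatible _ _ (sigma i)) => //.
by case: (system i).
Qed.

Lemma sigma_word_compatible w : compatible (sigma_word sigma w).
Proof.
elim: w => [|i w IH] a b //=.
by rewrite (sigma_compatible i a _) (IH a b).
Qed.

(** Moving [b] to the left across [w] produces images of [b] under composites of
    the [sigma i] and [delta i], and [a] annihilates all of them. *)
Lemma word_annihilate a b w : a * b = 0 -> iota a * word x w * iota b = 0.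
Proof.
elim/last_ind: w b => [|w i IH] b ab.
  by rewrite word0 mulr1 -rmorphM ab rmorph0.
rewrite -cats1 word_cat word1 mulrA -mulrA (x_iota system) mulrDr mulrA.
rewrite !IH ?mul0r ?addr0 //; first exact: delta_weakly_compatible.
by apply/sigma_compatible.
Qed.

Lemma stdmon_annihilate a b al be :
  a * b = 0 -> iota a * stdmon x al * (iota b * stdmon x be) = 0.
Proof.
by move=> ab; rewrite [stdmon x al]stdmon_word mulrA word_annihilate // mul0r.
Qed.

(** The extremal pair argument. Let [(i, j)] be a pair with [a i * b j != 0] that
    is maximal for [key], and [ga] its exponent sum. In [iota (b j) * f * g] a pair
    [(k, l)] with [a k * b l = 0] contributes nothing, and one with a smaller
    exponent sum does not reach [ga]. If the sum is [ga] and [Y l < Y j], then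
    [X k + Y j] exceeds [ga], so that [a k * b j = 0] by maximality and
    [b j * a k = 0]: the factor [b j] kills this pair. *)
Lemma zero_prod_coefs (I J : finType) (a : I -> R) (X : I -> 'X_{1..n})
    (b : J -> R) (Y : J -> 'X_{1..n}) :
  injective X -> injective Y ->
  (\sum_i iota (a i) * stdmon x (X i))
    * (\sum_j iota (b j) * stdmon x (Y j)) = 0 ->
  forall i j, a i * b j = 0.
Proof.
move=> injX injY fg0 i0 j0; apply/eqP/negPn/negP => ab0.
pose P (p : I * J) := a p.1 * b p.2 != 0.
(* The lexicographic comparison realizes the two successive maximizations. *)
pose key (p : I * J) : 'X_{1..n} *l 'X_{1..n} := ((X p.1 + Y p.2)%MM, Y p.2).
have [[i j] /= Pij maxij] :=
  @Order.TotalTheory.arg_maxP _ _ _ (i0, j0) P key ab0.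
pose ga := (X i + Y j)%MM.
have basis : stdmon_basis iota x by case: PBW.
have others p : p != (i, j) ->
    coef iota x ga (iota (b j) * (iota (a p.1) * stdmon x (X p.1)
      * (iota (b p.2) * stdmon x (Y p.2)))) = 0.
  case: p => k l /= klij.
  have [kl0|klN0] := eqVneq (a k * b l) 0.
    by rewrite stdmon_annihilate // mulr0 coef0.
  have := maxij (k, l) klN0; rewrite /key Order.ProdLexiOrder.leEprodlexi /=.
  rewrite -/ga => /andP[le_ga eq_ga].
  have [e|neq] := eqVneq (X k + Y l)%MM ga; last first.
    rewrite (coef_scale basis).
    have [c [c' [_ ->]]] :=
      coef_prod PBW system redR (a k) (b l) (lemc_mdeg le_ga).
    by rewrite (negPf neq) mulr0.
  move: eq_ga; rewrite e lexx /= le_eqVlt => /orP[/eqP/injY el|lt_lj].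
    by move: e klij; rewrite el => /addIm/injX->; rewrite eqxx.
  have kj0 : a k * b j = 0.
    apply/eqP/negPn/negP => /(maxij (k, j)).
    rewrite /key Order.ProdLexiOrder.leEprodlexi /= -/ga => /andP[].
    by rewrite leNgt -e ltmc_add2r lt_lj.
  rewrite !mulrA -rmorphM (reduced_mul_eq0C redR kj0) rmorph0 !mul0r.
  exact: coef0.
have := congr1 (coef iota x ga) (congr1 ( *%R (iota (b j))) fg0).
rewrite mulr0 coef0 // big_distrlr /= pair_big /= mulr_sumr coef_sum //.
rewrite (bigD1 (i, j)) //= big1 ?addr0 => [|p /others//].
rewrite (coef_scale basis).
have [c [c' [cc' ->]]] := coef_prod PBW system redR (a i) (b j) (leqnn (mdeg ga)).
rewrite eqxx => /(congr1 ( *%R^~ c')).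
rewrite mul0r -!mulrA cc' mulr1 mulrA => /sigma_word_compatible bab.
move/negP: Pij; apply; apply/eqP/(reduced_sqr_eq0 redR).
by rewrite -mulrA (mulrA (b j)) bab mulr0.
Qed.

Lemma rigid_reduced : reduced A.
Proof.
apply: sqr_eq0_reduced => f ff0; have [_ basis _ _] := PBW.
have [m [a [X [injX def_f]]]] := injective_lincomb basis f.
rewrite {}def_f in ff0 *; rewrite big1 // => i _.
have /(reduced_sqr_eq0 redR) -> := zero_prod_coefs injX injX ff0 i i.
by rewrite rmorph0 mul0r.
Qed.

Lemma rigid_skew_Armendariz : skew_Armendariz iota x.
Proof.
move=> m t a X b Y [_ injX] [_ injY] fg0 k.
exact: (zero_prod_coefs injX injY fg0).
Qed.

Lemma rigid_Armendariz : Sigma_Delta_Armendariz iota x.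
Proof.
move=> m t a X b Y [_ injX] [_ injY] fg0 i j.
by rewrite stdmon_annihilate // (zero_prod_coefs injX injY fg0).
Qed.

Lemma rigid_Sigma_compatible : Sigma_compatible sigma.
Proof. by move=> a b al; apply: compatible_iter => i; apply: sigma_compatible. Qed.

Lemma rigid_Delta_compatible : Delta_compatible delta.
Proof.
move=> a b be; apply: weakly_compatible_iter => i.
exact: delta_weakly_compatible.
Qed.

End ZeroProducts.

(** * Rigidity from each of the other conditions *)

Section Converses.

Variables (R A : pzRingType) (iota : {rmorphism R -> A}).
Variables (n : nat) (x : 'I_n -> A).
Variables (sigma : 'I_n -> {rmorphism R -> R}).
Variables (delta : 'I_n -> {additive R -> R}).

Lemma sigma_powU i a : sigma_pow sigma U_(i)%MM a = sigma i a.
Proof. exact: iter_compU. Qed.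

Lemma mnm1_neq0 (i : 'I_n) : U_(i)%MM != 0%MM :> 'X_{1..n}.
Proof. by rewrite -mdeg_eq0 mdeg1. Qed.

Lemma Sigma_rigid_reduced : Sigma_rigid sigma -> reduced R.
Proof.
move=> rig; apply: sqr_eq0_reduced => a aa; apply: (rig a 0%MM).
by rewrite /sigma_pow iter_comp0.
Qed.

Hypothesis PBW : skew_PBW_extension iota x.
Hypothesis system : PBW_system iota x sigma delta.

Lemma sigma_inj0 i a : sigma i a = 0 -> a = 0.
Proof. by have [inj _ _] := system i => e; apply: inj; rewrite rmorph0. Qed.

(** The condition is applied to [sigma i a * a = 0], not to [a * sigma i a = 0]:
    it then yields the square of [sigma i a]. *)
Lemma semicommutative_rigid i :
  reduced R -> Sigma_semicommutative sigma -> rigid (sigma i).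
Proof.
move=> redR semi a /(reduced_mul_eq0C redR) /semi/(_ _ (mnm1_neq0 i) 1).
by rewrite mulr1 sigma_powU => /(reduced_sqr_eq0 redR)/sigma_inj0.
Qed.

Lemma reduced_extension_reduced : reduced A -> reduced R.
Proof.
have [inj _ _ _] := PBW; move=> redA; apply: sqr_eq0_reduced => a aa.
apply: inj; rewrite rmorph0; apply: (reduced_sqr_eq0 redA).
by rewrite -rmorphM aa rmorph0.
Qed.

Lemma linear_eq0 i a b : iota a * x i + iota b = 0 -> a = 0 /\ b = 0.
Proof.
by move=> e; apply: (linear_coef_inj PBW (i := i)); rewrite e rmorph0 mul0r addr0.
Qed.

(** In the reduced ring [A], [x i] may be inserted in [sigma i a * a = 0]; the
    coefficient of [x i] in the result is [sigma i a] squared. *)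
Lemma reduced_extension_rigid i : reduced A -> rigid (sigma i).
Proof.
move=> redA a /(reduced_mul_eq0C (reduced_extension_reduced redA)) saa.
have : iota (sigma i a) * x i * iota a = 0.
  by apply: (reduced_mul_ins redA); rewrite -rmorphM saa rmorph0.
rewrite -mulrA (x_iota system) mulrDr mulrA -!rmorphM => /linear_eq0[].
by move=> /sigma_inj0/(reduced_sqr_eq0 (reduced_extension_reduced redA)).
Qed.

Lemma Armendariz_skew_Armendariz :
  Sigma_Delta_Armendariz iota x -> skew_Armendariz iota x.
Proof.
have [_ basis _ _] := PBW.
move=> arm m t a X b Y admX admY fg0 k; have [X0 _] := admX.
have := arm _ _ _ _ _ _ admX admY fg0 ord0 k.
rewrite X0 stdmon0 mulr1 mulrA -rmorphM => /(congr1 (coef iota x (Y k))).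
by rewrite coef_stdmon // eqxx coef0.
Qed.

Lemma skew_Armendariz_linear i a0 a1 b0 b1 : skew_Armendariz iota x ->
  (iota a0 + iota a1 * x i) * (iota b0 + iota b1 * x i) = 0 ->
  a0 * b0 = 0 /\ a0 * b1 = 0.
Proof.
move=> arm e.
pose X (k : 'I_2) : 'X_{1..n} := if k == ord0 then 0%MM else U_(i)%MM.
pose pair_of (c0 c1 : R) (k : 'I_2) := if k == ord0 then c0 else c1.
have admX : admissible X.
  split=> // k l; rewrite /X; case: eqVneq => [->|k0]; case: eqVneq => [->|l0] //.
  - by move/eqP; rewrite eq_sym (negPf (mnm1_neq0 i)).
  - by move/eqP; rewrite (negPf (mnm1_neq0 i)).
  - by move=> _; apply/val_inj; case: k l k0 l0 => [[|[|]]] // ? [[|[|]]].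
have sumX c0 c1 : stdsum iota x (pair_of c0 c1) X = iota c0 + iota c1 * x i.
  by rewrite /stdsum big_ord_recl big_ord1 /X /pair_of /= stdmon0 mulr1 stdmonU.
have fg0 : stdsum iota x (pair_of a0 a1) X * stdsum iota x (pair_of b0 b1) X = 0.
  by rewrite !sumX.
have ab := arm _ _ _ _ _ _ admX admX fg0.
by have := ab ord_max; have := ab ord0.
Qed.

(** First [delta i] is shown to preserve zero products, from
    [(x i * b) * c = 0]. This removes the terms with [delta i] from the product
    [(s + s * x i) * (a - s * x i)], where [s := sigma i a]. Its constant and
    quadratic terms vanish because [s * a] and [a * s] do, and the two linear terms
    [s * sigma i a * x i] and [- s * s * x i] cancel. The product is therefore [0],
    and the constant term [s] annihilates the coefficient [- s]. *)
Lemma skew_Armendariz_rigid i :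
  reduced R -> skew_Armendariz iota x -> rigid (sigma i).
Proof.
move=> redR arm a asa.
have dab b c : b * c = 0 -> delta i b * c = 0.
  move=> bc; have := @skew_Armendariz_linear i (delta i b) (sigma i b) c 0 arm.
  rewrite rmorph0 mul0r addr0 addrC -(x_iota system) -mulrA -rmorphM bc.
  by rewrite rmorph0 mulr0 => /(_ erefl)[].
have saa := reduced_mul_eq0C redR asa.
have sada : sigma i a * delta i a = 0.
  exact/(reduced_mul_eq0C redR)/dab.
have sadsa : sigma i a * delta i (sigma i a) = 0.
  have [_ dM _] := system i; have := dM a (sigma i a).
  by rewrite asa raddf0 dab // addr0.
have e1 : iota (sigma i a) * x i * iota a = iota (sigma i a * sigma i a) * x i.
  rewrite -mulrA (x_iota system) mulrDr -[iota _ * iota (delta _ _)]rmorphM.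
  by rewrite sada rmorph0 addr0 mulrA -rmorphM.
have e2 : iota (sigma i a) * x i * iota (sigma i a) = 0.
  rewrite -mulrA (x_iota system) mulrDr mulrA -!rmorphM sadsa.
  by rewrite asa !rmorph0 mul0r addr0.
have [|_] :=
  @skew_Armendariz_linear i (sigma i a) (sigma i a) a (- sigma i a) arm.
  rewrite rmorphN mulNr mulrDl !mulrBr (mulrA (iota _ * x i)) e1 e2.
  by rewrite mul0r subr0 -rmorphM saa rmorph0 sub0r mulrA -rmorphM addNr.
rewrite mulrN => /eqP; rewrite oppr_eq0 => /eqP.
by move=> /(reduced_sqr_eq0 redR)/sigma_inj0.
Qed.

End Converses.

Theorem theorem4p3 (R A : pzRingType) (iota : {rmorphism R -> A})
    (n : nat) (x : 'I_n -> A)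
    (sigma : 'I_n -> {rmorphism R -> R}) (delta : 'I_n -> {additive R -> R})
    (PBW : skew_PBW_extension iota x)
    (system : PBW_system iota x sigma delta) :
  [<-> (* (1) *) Sigma_semicommutative sigma /\ reduced R;
       (* (2) *) Sigma_rigid sigma;
       (* (3) *) Sigma_Delta_Armendariz iota x /\ reduced R;
       (* (4) *) reduced A;
       (* (5) *) reduced R /\ Sigma_Delta_compatible sigma delta;
       (* (6) *) reduced R /\ skew_Armendariz iota x].
Proof.
tfae.
- move=> [semi redR] a al.
  have rig i : rigid (sigma i) by apply: (semicommutative_rigid system).
  by move/(rigid_Sigma_compatible redR rig)/(reduced_sqr_eq0 redR).
- move=> rig; have redR := Sigma_rigid_reduced rig; split=> //.
  apply: (rigid_Armendariz PBW system redR) => i a.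
  by rewrite -sigma_powU; apply: rig.
- move=> [arm redR]; apply: (rigid_reduced PBW system redR) => i.
  apply: (skew_Armendariz_rigid system redR).
  exact: (Armendariz_skew_Armendariz PBW).
- move=> redA; have redR := reduced_extension_reduced PBW redA.
  have rig i : rigid (sigma i) by apply: (reduced_extension_rigid PBW system).
  split=> //; split; first exact: rigid_Sigma_compatible.
  exact: rigid_Delta_compatible.
- move=> [redR [sC _]]; split=> //.
  apply: (rigid_skew_Armendariz PBW system redR) => i.
  by apply: compatible_rigid => // a b; rewrite -sigma_powU; apply: sC.
- move=> [redR arm]; split=> // a b ab al _ r.
  have rig i : rigid (sigma i).
    exact: (skew_Armendariz_rigid system redR arm).
  exact/(rigid_Sigma_compatible redR rig)/reduced_mul_ins.
Qed.
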